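(* Let $k\ge 2$ be an integer and let $P=\mathrm{tconv}(\mathbf v_1,\dots,\mathbf v_k)\subset\mathbb R^k/\mathbb R\mathbbm 1$ be any full-dimensional biconvex polytope, maximal or not. For each vertex $\mathbf w$ of $P$ let $\mathbf w=\mathbf v_1^{C_1}\cdots\mathbf v_k^{C_k}$ be an expression of $\mathbf w$. Then the monomial map $$\mu:\{\text{vertices of }P\}\to\{\text{degree-}(k-1)\text{ monomials in }x_1,\dots,x_k\},\qquad \mathbf w=\mathbf v_1^{C_1}\cdots\mathbf v_k^{C_k}\mapsto x_1^{|C_1|}\cdots x_k^{|C_k|},$$ is injective.
   Context: Notation: $[k]=\{1,\dots,k\}$; $\mathbbm 1=(1,\dots,1)\in\mathbb R^k$. For $a\in\mathbb R$ and $\mathbf x,\mathbf y\in\mathbb R^k$ put $a\odot\mathbf x=a\mathbbm 1+\mathbf x$ and let $\mathbf x\boxplus\mathbf y$ be the entrywise minimum. A subset of $\mathbb R^k$ is tropically convex if it is closed under all tropical linear combinations $a_1\odot\mathbf x_1\boxplus\cdots\boxplus a_n\odot\mathbf x_n$ ($a_i\in\mathbb R$); $\mathrm{tconv}(V)$ is the smallest tropically convex set containing $V$. These notions descend to $\mathbb R^k/\mathbb R\mathbbm 1$. A biconvex polytope is an (ordinary) convex polytope in $\mathbb R^k/\mathbb R\mathbbm 1$ that is the tropical convex hull of finitely many points; it is full-dimensional if it has dimension $k-1$. A full-dimensional biconvex polytope $P$ has a unique inclusionwise minimal generating set, consisting of $k$ points $\mathbf v_1,\dots,\mathbf v_k$,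 all vertices of $P$, and at most $\binom{2k-2}{k-1}$ vertices; it is called maximal if it has exactly that many. The generators are indexed so that $P=\bigcap_{i\in[k]}\bar E_i$, where $\bar E_i=\{\mathbf x: x_j-x_j(\mathbf v_i)\le x_i-x_i(\mathbf v_i)\text{ for all } j\in[k]\setminus\{i\}\}$ is the $i$-th max-sector with apex $\mathbf v_i$ ($x_j(\mathbf v)$ is the $j$-th coordinate of $\mathbf v$). For $l\ne i$, the $\{i,l\}$-facet of $\bar E_i$ is its subset where $x_l-x_l(\mathbf v_i)=x_i-x_i(\mathbf v_i)$. For a vertex $\mathbf w$ of $P$ and $i\in[k]$ let $C_i^{\mathbf w}=\{l\in[k]\setminus\{i\}:\mathbf w\in\text{the }\{i,l\}\text{-facet of }\bar E_i\}$ (possibly empty). An expression $\mathbf w=\mathbf v_1^{C_1}\cdots\mathbf v_k^{C_k}$ of a vertex $\mathbf w$ is a choice of subsets $C_i\subseteq C_i^{\mathbf w}$ ($i\in[k]$) with $\sum_{i\in[k]}|C_i|=k-1$ such that the $k-1$ hyperplanes $\{x_l-x_l(\mathbf v_i)=x_i-x_i(\mathbf v_i)\}$, for $i\in[k]$ and $l\in C_i$, of $\mathbb R^k/\mathbb R\mathbbm 1$ meet exactly in the point $\mathbf w$. If $P$ is maximal, the expression of each vertex is unique, with $C_i=C_i^{\mathbf w}$; if $P$ is not maximal, expressions exist but need not be unique. *)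

(* Defs.v *)
From HB Require Import structures.
From mathcomp Require Import all_boot all_order all_algebra.
From mathcomp Require Import boolp classical_sets functions cardinality reals.
From mathcomp Require Import interval_inference convex.
(* [mpoly] is not imported: its notations clash with those of the
   classical-set and convexity files. *)
From mathcomp Require mpoly.

Set Implicit Arguments.
Unset Strict Implicit.
Unset Printing Implicit Defensive.

Import Order.TTheory GRing.Theory Num.Theory.
Local Open Scope classical_set_scope.
Local Open Scope quotient_scope.
Local Open Scope ring_scope.

Definition diag_line (F : fieldType) (k : nat) : {pred 'rV[F]_k} :=
  [pred x | (x <= (const_mx 1 : 'rV[F]_k))%MS].

Section TropicalTorus.
Context (F : fieldType) (k : nat).

Fact diag_line_zmod_closed : zmod_closed (@diag_line F k).
Proof. by split=> [|x y xL yL]; rewrite !inE ?sub0mx// addmx_sub ?eqmx_opp. Qed.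

HB.instance Definition _ :=
  GRing.isZmodClosed.Build 'rV[F]_k (@diag_line F k) diag_line_zmod_closed.

(* The space R^k / R(1,...,1). *)
Definition torus := Quotient.quot (@diag_line F k).

HB.instance Definition _ : EqQuotient _ (Quotient.equiv (@diag_line F k)) torus
  := EqQuotient.on torus.
HB.instance Definition _ := Choice.on torus.
HB.instance Definition _ := ZmodQuotient.on torus.

Lemma torus_eqP (x y : 'rV[F]_k) :
  reflect (exists a : F, x = const_mx a + y) (x == y %[mod torus]).
Proof.
rewrite -Quotient.idealrBE inE; apply: (iffP sub_rVP) => -[a xya]; exists a.
  by rewrite -[LHS](subrK y) xya; apply/rowP=> i; rewrite !mxE mulr1.
by rewrite xya addrK; apply/rowP=> i; rewrite !mxE mulr1.
Qed.

Definition torus_scale (a : F) : torus -> torus := lift_op1 torus ( *:%R a).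

Fact pi_torus_scale a :
  {morph \pi_torus : x / a *: x >-> torus_scale a x}.
Proof.
move=> x; unlock torus_scale; apply/eqP/torus_eqP.
have /torus_eqP[b xb] : x == repr (\pi_torus x) %[mod torus] by rewrite reprK.
exists (a * b); rewrite {1}xb scalerDr.
by congr (_ + _); apply/rowP=> i; rewrite !mxE.
Qed.

Fact torus_scaleA a b x : torus_scale a (torus_scale b x) = torus_scale (a * b) x.
Proof. by rewrite -[x]reprK -!pi_torus_scale scalerA. Qed.

Fact torus_scale1 : left_id 1 torus_scale.
Proof. by move=> x; rewrite -[x]reprK -pi_torus_scale scale1r. Qed.

Fact torus_scaleDr : right_distributive torus_scale +%R.
Proof.
move=> a x y; rewrite -[x]reprK -[y]reprK.
by rewrite -raddfD /= -!pi_torus_scale scalerDr raddfD.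
Qed.

Fact torus_scaleDl x : {morph torus_scale^~ x : a b / a + b}.
Proof.
by move=> a b; rewrite -[x]reprK -!pi_torus_scale scalerDl raddfD.
Qed.

HB.instance Definition _ := GRing.Zmodule_isLmodule.Build F torus
  torus_scaleA torus_scale1 torus_scaleDr torus_scaleDl.

(* The coordinates depend on the choice of a representative; the (in)equalities
   below compare two coordinates of the same points, hence only depend on the
   differences described by [crdB]. *)
Definition crd (x : torus) (i : 'I_k) : F := repr x 0 i.

Lemma crdB (x : 'rV[F]_k) i j :
  crd (\pi_torus x) i - crd (\pi_torus x) j = x 0 i - x 0 j.
Proof.
rewrite /crd; have /torus_eqP[a ->] : repr (\pi_torus x) == x %[mod torus].
  by rewrite reprK.
by rewrite !mxE opprD addrACA subrr add0r.
Qed.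

End TropicalTorus.

Section TropicalConvexity.
Context (R : realType) (k : nat).
Implicit Types (V P : set (torus R k)) (v w : torus R k).

Definition tscale (a : R) (x : 'rV[R]_k) : 'rV[R]_k := const_mx a + x.

Definition tadd (x y : 'rV[R]_k) : 'rV[R]_k := map2_mx Num.min x y.

(* [tadd] has no neutral element, so the first term plays the role of the
   initial value. *)
Definition tcomb n (a : 'I_n.+1 -> R) (x : 'I_n.+1 -> 'rV[R]_k) : 'rV[R]_k :=
  \big[tadd/tscale (a ord0) (x ord0)]_(i < n)
    tscale (a (lift ord0 i)) (x (lift ord0 i)).

Definition tropically_convex_rV (A : set 'rV[R]_k) : Prop :=
  forall n (a : 'I_n.+1 -> R) (x : 'I_n.+1 -> 'rV[R]_k),
    (forall j, A (x j)) -> A (tcomb a x).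

(* Tropically convex sets of row vectors are stable by [tscale], hence are
   exactly the preimages of the subsets of the torus singled out here. *)
Definition tropically_convex V : Prop :=
  tropically_convex_rV (\pi_(torus R k) @^-1` V).

Definition tconv V : set (torus R k) := smallest tropically_convex V.

Definition sector (i : 'I_k) v : set (torus R k) :=
  [set x | forall j, j != i -> crd x j - crd v j <= crd x i - crd v i].

Definition hyperplane (i l : 'I_k) v : set (torus R k) :=
  [set x | crd x l - crd v l = crd x i - crd v i].

Definition facet (i l : 'I_k) v : set (torus R k) := sector i v `&` hyperplane i l v.

Definition minimal_generating_set P V : Prop :=
  tconv V = P /\ forall W, W `<=` V -> tconv W = P -> W = V.

Definition facet_indices (v : 'I_k -> torus R k) w i : set 'I_k :=
  [set l | l != i /\ facet i l (v i) w].

Definition expression (v : 'I_k -> torus R k) w (C : 'I_k -> {set 'I_k}) : Prop :=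
  [/\ forall i, [set` C i] `<=` facet_indices v w i,
      (\sum_i #|C i|)%N = k.-1 &
      \bigcap_i \bigcap_(l in [set` C i]) hyperplane i l (v i) = [set w]].

(* The monomial x_1^|C_1| ... x_k^|C_k|, given by its exponents. *)
Definition monomial (C : 'I_k -> {set 'I_k}) : mpoly.multinom k :=
  mpoly.Multinom [tuple #|C i| | i < k].

End TropicalConvexity.

Section Polytopes.
Context (R : realType) (E : lmodType R).
Implicit Types A P : set E.

Definition conv_hull A : set E := smallest (@convex_set R E) A.

Definition convex_polytope P : Prop :=
  exists2 A, finite_set A & conv_hull A = P.

Definition aff_independent n (x : 'I_n -> E) : Prop :=
  forall c : 'I_n -> R, \sum_i c i = 0 -> \sum_i c i *: x i = 0 ->
    forall i, c i = 0.

Definition has_dim A (d : nat) : Prop :=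
  (exists2 x : 'I_d.+1 -> E, (forall i, A (x i)) & aff_independent x) /\
  ~ (exists2 x : 'I_d.+2 -> E, (forall i, A (x i)) & aff_independent x).

(* For a polytope, the vertices are the extreme points. *)
Definition vertices P : set E :=
  [set w | P w /\ forall x y (t : R), P x -> P y -> 0 < t < 1 ->
     w = t *: x + (1 - t) *: y -> x = y].

End Polytopes.

Definition biconvex_polytope (R : realType) (k : nat) (P : set (torus R k)) : Prop :=
  convex_polytope P /\ exists2 V, finite_set V & tconv V = P.

Definition full_dimensional (R : realType) (k : nat) (P : set (torus R k)) : Prop :=
  has_dim P k.-1.

(* Main.v *)
Require Import Defs.
From mathcomp Require Import all_boot all_order all_algebra.
From mathcomp Require Import boolp classical_sets functions cardinality reals.
From mathcomp Require Import lra.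
From mathcomp Require mpoly.
Local Open Scope classical_set_scope.

(** Read the subsets of an expression of a vertex [w] as a directed graph on
    ['I_k], with an edge from [i] to [l] for each [l] in [C i]: it has [k - 1]
    edges, and its monomial records the out-degrees.  The edge from [i] to [l]
    stands for an equation that prescribes [x_l - x_i].  Since the equations have
    only one common solution, the [k - 1] edges form a spanning tree, so at most
    [#|S| - 1] of them lie inside a nonempty set [S] ([expression_inside_lt]).

    Let [w] and [w'] be distinct vertices and [d = w - w'], which is not
    constant.  An edge of [w] is an inequality, valid on the whole polytope, that
    is tight at [w]; comparing with [w'] shows that [d] does not decrease along
    it.  By symmetry [d] does not increase along the edges of [w'].  Let [S] be a
    superlevel set of [d], nonempty and proper.  The edges of [w] that start in
    [S] stay in [S], so there are at most [#|S| - 1] of them.  The edges of [w']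
    that start outside [S] stay outside [S], so there are at most [k - #|S| - 1]
    of them, and at least [#|S|] edges of [w'] start in [S].  Hence the
    out-degrees of the two graphs have different sums over [S]. *)

Set Implicit Arguments.
Unset Strict Implicit.
Unset Printing Implicit Defensive.

Import Order.TTheory GRing.Theory Num.Theory.
Local Open Scope quotient_scope.
Local Open Scope ring_scope.

(** The conditions form a homogeneous linear system with fewer equations than
    unknowns. *)
Lemma exists_vanishing_edge_constant (F : fieldType) (k : nat)
    (S : {set 'I_k}) (E : {set 'I_k * 'I_k}) :
  (#|S| + #|E| < k)%N ->
  exists d : 'rV[F]_k, [/\ d != 0, forall i, i \in S -> d 0 i = 0 &
    forall i l, (i, l) \in E -> d 0 l = d 0 i].
Proof.
move=> ltk.
pose A : 'M[F]_(k, #|S|) := \matrix_(i, j) (i == enum_val j)%:R.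
pose B : 'M[F]_(k, #|E|) :=
  \matrix_(i, j) ((i == (enum_val j).2)%:R - (i == (enum_val j).1)%:R).
have sum_delta (d : 'rV[F]_k) s : \sum_j d 0 j * (j == s)%:R = d 0 s.
  rewrite (bigD1 s) //= eqxx mulr1 big1 ?addr0 // => j /negPf->.
  by rewrite mulr0.
have /rowV0Pn[d /sub_kermxP + d0] : kermx (row_mx A B) != 0.
  rewrite kermx_eq0 /row_free; apply: contraTneq (rank_leq_col (row_mx A B)).
  by move=> ->; rewrite -ltnNge.
rewrite mul_mx_row => /eqP; rewrite row_mx_eq0 => /andP[/eqP dA /eqP dB].
exists d; split=> // [i iS|i l ilE].
  move/rowP: dA => /(_ (enum_rank_in iS i)); rewrite !mxE => <-.
  by under eq_bigr do rewrite mxE enum_rankK_in //; rewrite sum_delta.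
move/rowP: dB => /(_ (enum_rank_in ilE (i, l))); rewrite !mxE.
under eq_bigr do rewrite mxE enum_rankK_in //= mulrBr.
by rewrite sumrB !sum_delta => /eqP; rewrite subr_eq0 => /eqP.
Qed.

Lemma torus_crdP (F : fieldType) (k : nat) (x y : torus F k) :
  (forall i j, crd x i - crd y i = crd x j - crd y j) -> x = y.
Proof.
case: k x y => [|k] x y xy; rewrite -[x]reprK -[y]reprK; apply/eqP/torus_eqP.
  by exists 0; apply/rowP => -[].
exists (crd x ord0 - crd y ord0); apply/rowP => i.
by rewrite (xy _ i) !mxE subrK.
Qed.

Definition edges (k : nat) (C : 'I_k -> {set 'I_k}) : {set 'I_k * 'I_k} :=
  [set p | p.2 \in C p.1].

Lemma card_edges_from (k : nat) (C : 'I_k -> {set 'I_k}) (S : {set 'I_k}) :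
  #|edges C :&: finset.setX S finset.setT| = (\sum_(i in S) #|C i|)%N.
Proof.
under [RHS]eq_bigr do rewrite -sum1_card.
rewrite pair_big_dep -sum1_card; apply: eq_bigl => p.
by rewrite !inE andbT andbC.
Qed.

(** Otherwise fewer than [k - #|S|] edges have an endpoint outside [S], and some
    nonzero vector vanishes on [S] and is constant along these edges, hence along
    all edges.  Adding it to [w] gives a second common point of the hyperplanes. *)
Lemma expression_inside_lt (R : realType) (k : nat) (v : 'I_k -> torus R k)
    (w : torus R k) (C : 'I_k -> {set 'I_k}) (S : {set 'I_k}) :
  expression v w C -> S != finset.set0 ->
  (#|edges C :&: finset.setX S S| < #|S|)%N.
Proof.
move=> [_ degC capC] /set0Pn[s sS]; rewrite ltnNge; apply/negP => leS.
have cardE : #|edges C| = k.-1.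
  rewrite -degC -(eq_bigl _ _ (@finset.in_setT _)) -card_edges_from.
  by apply: fintype.eq_card => p; rewrite !inE !andbT.
have ltk : (#|S| + #|edges C :\: finset.setX S S| < k)%N.
  apply: leq_ltn_trans (leq_add leS (leqnn _)) _.
  by rewrite cardsID cardE prednK ?(leq_ltn_trans _ (ltn_ord s)).
have [d [d0 dS dE]] := exists_vanishing_edge_constant R ltk.
have dC i l : l \in C i -> d 0 l = d 0 i.
  move=> lC; have ilE : (i, l) \in edges C by rewrite inE.
  have [/[!inE]/= /andP[iS lS]|ilN] := boolP ((i, l) \in finset.setX S S).
    by rewrite !dS.
  by apply: dE; rewrite inE ilN.
pose x : torus R k := \pi_(torus R k) (repr w + d).
have crdx i l : crd x i - crd x l = (crd w i - crd w l) + (d 0 i - d 0 l).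
  by rewrite crdB !mxE /crd; lra.
have xw : x = w.
  have : [set w] w by [].
  rewrite -capC => capw; suff : [set w] x by [].
  rewrite -capC => i _ l lC; have := capw i I l lC; rewrite /hyperplane /=.
  by have := crdx l i; rewrite (dC i l lC); lra.
case/negP: d0; apply/eqP/rowP => i; have := crdx i s.
by rewrite xw (dS s sS) mxE; lra.
Qed.

(** No edge leaves [S], so the edges that start in [S] lie inside [S]. *)
Lemma sum_expression_closed_lt (R : realType) (k : nat) (v : 'I_k -> torus R k)
    (w : torus R k) (C : 'I_k -> {set 'I_k}) (S : {set 'I_k}) :
  expression v w C -> S != finset.set0 ->
  (forall i l, l \in C i -> i \in S -> l \in S) ->
  (\sum_(i in S) #|C i| < #|S|)%N.
Proof.
move=> Cw S0 CS; apply: leq_trans (expression_inside_lt Cw S0).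
rewrite ltnS -card_edges_from; apply/subset_leq_card/fintype.subsetP => p.
by rewrite !inE => /and3P[pC pS _]; rewrite pC pS (CS _ _ pC pS).
Qed.

(** The inequality of a sector that is tight at [w] holds at [w']. *)
Lemma expression_edge_le (R : realType) (k : nat) (v : 'I_k -> torus R k)
    (w w' : torus R k) (C : 'I_k -> {set 'I_k}) (i l : 'I_k) :
  expression v w C -> (\bigcap_j sector j (v j)) w' -> l \in C i ->
  crd w i - crd w' i <= crd w l - crd w' l.
Proof.
move=> [subC _ _] Pw' /subC[li [_]]; have := Pw' i I l li.
by rewrite /hyperplane /=; lra.
Qed.

Theorem proposition2p5 (R : realType) (k : nat) (hk : (2 <= k)%N)
    (P : set (torus R k)) (v : 'I_k -> torus R k)
    (P_biconvex : biconvex_polytope P) (P_full : full_dimensional P)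
    (v_inj : injective v) (v_gen : minimal_generating_set P (range v))
    (P_sectors : P = \bigcap_i sector i (v i))
    (C : torus R k -> 'I_k -> {set 'I_k})
    (C_expr : forall w, vertices P w -> expression v w (C w)) :
  (forall w, vertices P w -> mpoly.mdeg (monomial (C w)) = k.-1) /\
  set_inj (vertices P) (fun w => monomial (C w)).
Proof.
split=> [w /C_expr[_ <- _]|w w' /set_mem Vw /set_mem Vw' eqC].
  rewrite mpoly.mdegE; apply: eq_bigr => i _.
  by rewrite mpoly.multinomE tnth_mktuple.
have cardC i : #|C w i| = #|C w' i|.
  by move/mpoly.mnmP: eqC => /(_ i); rewrite !mpoly.multinomE !tnth_mktuple.
have [Cw Cw'] := (C_expr w Vw, C_expr w' Vw').
have [Pw Pw'] : P w /\ P w' by case: Vw; case: Vw'.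
rewrite P_sectors in Pw Pw'.
pose d i := crd w i - crd w' i.
suff no_lt a b : ~ d b < d a.
  apply: torus_crdP => i j.
  by have [/no_lt|/no_lt|] := ltgtP (d i) (d j).
move=> ltba; pose S := [set i | d a <= d i]%SET.
have sumS : (\sum_(i in S) #|C w i| < #|S|)%N.
  apply: (sum_expression_closed_lt Cw) => [|i l lC].
    by apply/set0Pn; exists a; rewrite inE.
  by rewrite !inE => /le_trans; apply; apply: (expression_edge_le Cw Pw' lC).
have sumSC : (\sum_(i in ~: S) #|C w' i| < #|~: S|)%N.
  apply: (sum_expression_closed_lt Cw') => [|i l lC].
    by apply/set0Pn; exists b; rewrite !inE -ltNge.
  rewrite !inE -!ltNge; apply: le_lt_trans.
  by have := expression_edge_le Cw' Pw lC; rewrite /d; lra.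
(* The edges of [w] from [S] and those of [w'] from its complement number at
   most [k - 2] together, but equal out-degrees make this sum [k - 1]. *)
have [_ degC' _] := Cw'; move: degC'; rewrite (bigID (mem S)) /=.
under eq_bigr do rewrite -cardC.
under [X in (_ + X)%N]eq_bigl do rewrite -finset.in_setC.
move=> degC'; have := leq_add sumS sumSC.
by rewrite addSn addnS degC' cardsC card_ord prednK ?ltnn // ltnW.
Qed.
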